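(* Let $n\ge 3$ and let $x_1,x_2,\dots,x_n$ be $n$ positive real numbers, with arithmetic mean $A$, geometric mean $G$ and second and third moments $m_2'$ and $m_3'$. Then $$G\leq A\left(\frac{n^{2}}{(n-1)(n-2)}\left(1-\frac{3}{n}\frac{m_{2}'}{A^{2}}+\frac{2}{n^{2}}\frac{m_{3}'}{A^{3}}\right)\right)^{\frac13}.$$
   Context: For positive real numbers $x_1,\dots,x_n$: $A=\frac1n\sum_{i=1}^n x_i$, $G=\left(\prod_{i=1}^n x_i\right)^{1/n}$, and $m_r'=\frac1n\sum_{i=1}^n x_i^r$ for $r=2,3$. *)

(* Defs.v *)
From mathcomp Require Import all_boot all_order all_algebra.
From mathcomp Require Import all_classical all_reals all_analysis.

Set Implicit Arguments.
Unset Strict Implicit.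
Unset Printing Implicit Defensive.

Import Order.TTheory GRing.Theory Num.Theory.
Local Open Scope ring_scope.

Definition arith_mean (R : realType) (n : nat) (x : 'I_n -> R) : R :=
  n%:R^-1 * \sum_(i < n) x i.

Definition geom_mean (R : realType) (n : nat) (x : 'I_n -> R) : R :=
  (\prod_(i < n) x i) `^ n%:R^-1.

(* Moment about the origin, not about the mean. *)
Definition raw_moment (R : realType) (n : nat) (r : nat) (x : 'I_n -> R) : R :=
  n%:R^-1 * \sum_(i < n) x i ^+ r.

(* Main.v *)
(** Newton's identities turn the right-hand side into the cube root of the
    average of [x i * x j * x k] over triples of distinct indices.  Writing
    [x i = G * expR (l i)] with [\sum_i l i = 0], the bound [1 + t <= expR t]
    gives [x i * x j * x k >= G ^+ 3 * (1 + l i + l j + l k)], and by symmetry the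
    linear terms cancel in the sum over all these triples. *)

Require Import Defs.
From mathcomp Require Import all_boot all_order all_algebra.
From mathcomp Require Import all_classical all_reals all_analysis.
From mathcomp Require Import ring lra.

Set Implicit Arguments.
Unset Strict Implicit.
Unset Printing Implicit Defensive.

Import Order.TTheory GRing.Theory Num.Theory.
Local Open Scope ring_scope.

(** Inclusion-exclusion on the coincidences [i = j], [i = k], [j = k]: a fully diagonal term is
    counted once and removed three times, hence the correction by 2. Three separate functions allow
    mixed products of constants and logarithms as well as [x i * x j * x k]. *)
Lemma sum_distinct_triples (R : comPzRingType) (I : finType) (a b c : I -> R) :
  \sum_i \sum_(j | j != i) \sum_(k | (k != i) && (k != j)) a i * b j * c k =
  (\sum_i a i) * (\sum_i b i) * (\sum_i c i)
  - (\sum_i a i * b i) * (\sum_i c i) - (\sum_i a i * c i) * (\sum_i b i)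
  - (\sum_i b i * c i) * (\sum_i a i) + (\sum_i a i * b i * c i) *+ 2.
Proof.
have sumD1 (f : I -> R) i : \sum_(j | j != i) f j = \sum_j f j - f i.
  by rewrite (bigD1 i (P := xpredT)) //= addrC addrK.
have sumD2 i j : j != i ->
    \sum_(k | (k != i) && (k != j)) a i * b j * c k
    = a i * (b j * (\sum_k c k - c i) - b j * c j).
  move=> ji; have := sumD1 c i; rewrite (bigD1 j) //= => E.
  by rewrite -E -mulr_sumr; ring.
pose B := \sum_j b j; pose C := \sum_k c k; pose BC := \sum_j b j * c j.
transitivity (\sum_i (a i * (B * C - BC) - (a i * b i) * C - (a i * c i) * B
    + (a i * b i * c i) *+ 2)).
  apply: eq_bigr => i _; rewrite (eq_bigr _ (sumD2 i)) -mulr_sumr sumD1.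
  by rewrite sumrB -mulr_suml -/B -/C -/BC; ring.
rewrite big_split /= !sumrB -!mulr_suml -sumrMnl /B /C /BC; ring.
Qed.

Lemma sum_distinct_triples_ge (R : realType) (n : nat) (g : R) (x l : 'I_n -> R) :
  0 <= g -> (forall i, x i = g * expR (l i)) -> \sum_i l i = 0 ->
  g ^+ 3 * (n%:R * (n%:R - 1) * (n%:R - 2)) <=
  (\sum_i x i) ^+ 3 - 3 * (\sum_i x i) * (\sum_i x i ^+ 2)
  + 2 * (\sum_i x i ^+ 3).
Proof.
move=> g0 xE l0.
have xxx := sum_distinct_triples x x x.
have -> : (\sum_i x i) ^+ 3 - 3 * (\sum_i x i) * (\sum_i x i ^+ 2)
  + 2 * (\sum_i x i ^+ 3) =
  \sum_i \sum_(j | j != i) \sum_(k | (k != i) && (k != j)) x i * x j * x k.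
  rewrite xxx; under [\sum_i x i ^+ 2]eq_bigr do rewrite expr2.
  under [\sum_i x i ^+ 3]eq_bigr do rewrite exprS expr2 mulrA.
  ring.
(* The constant function turns 1 and each linear term such as [l j] into a product of three
   one-index factors, the shape required by [sum_distinct_triples]. *)
pose u (i : 'I_n) : R := 1.
have su : \sum_i u i = n%:R by rewrite sumr_const card_ord.
have ul : \sum_i u i * l i = 0 by under eq_bigr do rewrite mul1r.
have lu : \sum_i l i * u i = 0 by under eq_bigr do rewrite mulr1.
have uu : \sum_i u i * u i = n%:R by under eq_bigr do rewrite mulr1.
have uuu : \sum_i u i * u i * u i = n%:R by under eq_bigr do rewrite !mulr1.
have luu : \sum_i l i * u i * u i = 0 by under eq_bigr do rewrite !mulr1.
have ulu : \sum_i u i * l i * u i = 0 by under eq_bigr do rewrite mulr1 mul1r.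
have uul : \sum_i u i * u i * l i = 0 by under eq_bigr do rewrite !mul1r.
(* The term [u i * u j * u k] counts the ordered triples of distinct indices; each of the other
   three sums to a multiple of [\sum_i l i], which is 0. *)
have -> : g ^+ 3 * (n%:R * (n%:R - 1) * (n%:R - 2)) =
  \sum_i \sum_(j | j != i) \sum_(k | (k != i) && (k != j))
    g ^+ 3 * (u i * u j * u k + l i * u j * u k + u i * l j * u k
              + u i * u j * l k).
  under eq_bigr do under eq_bigr do rewrite -mulr_sumr !big_split /=.
  under eq_bigr do rewrite -mulr_sumr !big_split /=.
  rewrite -mulr_sumr !big_split /= !sum_distinct_triples.
  rewrite su ul lu uu uuu luu ulu uul l0; ring.
apply: ler_sum => i _; apply: ler_sum => j _; apply: ler_sum => k _.
rewrite !xE /u.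
have -> : g * expR (l i) * (g * expR (l j)) * (g * expR (l k))
   = g ^+ 3 * expR (l i + l j + l k) by rewrite !expRD; ring.
apply: ler_wpM2l; first exact: exprn_ge0.
by apply: le_trans (expR_ge1Dx _); rewrite !mulr1 !mul1r !addrA.
Qed.

Lemma ln_prod (R : realType) (I : finType) (x : I -> R) :
  (forall i, 0 < x i) -> ln (\prod_i x i) = \sum_i ln (x i).
Proof.
move=> x0; apply: expR_inj.
rewrite lnK ?posrE ?prodr_gt0 // expR_sum.
by apply: eq_bigr => i _; rewrite lnK ?posrE.
Qed.

Theorem theorem2p5 (R : realType) (n : nat) (x : 'I_n -> R)
  (hn : (3 <= n)%N) (hx : forall i : 'I_n, 0 < x i) :
  geom_mean x <=
  arith_mean x *
  (n%:R ^+ 2 / ((n%:R - 1) * (n%:R - 2)) *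
   (1 - 3 / n%:R * (raw_moment 2 x / arith_mean x ^+ 2)
      + 2 / n%:R ^+ 2 * (raw_moment 3 x / arith_mean x ^+ 3))) `^ (1 / 3).
Proof.
have n3 : 3 <= n%:R :> R by rewrite ler_nat.
have P0 : 0 < \prod_i x i by rewrite prodr_gt0.
have G0 : 0 < geom_mean x by rewrite powR_gt0.
have S0 : 0 < \sum_i x i.
  have i0 : 'I_n by exact: Ordinal hn.
  by rewrite (bigD1 i0) //= ltr_pwDl // sumr_ge0 // => i _; exact: ltW.
have A0 : 0 < arith_mean x by rewrite mulr_gt0 // invr_gt0; lra.
have cbrtK (y : R) : 0 <= y -> (y ^+ 3) `^ (1 / 3) = y.
  by move=> y0; rewrite -powR_mulrn // -powRrM mul1r divff ?powRr1 // pnatr_eq0.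
(* [ln (geom_mean x)] is the mean of the [ln (x i)], so the centred logarithms sum to 0. *)
have l0 : \sum_i (ln (x i) - ln (geom_mean x)) = 0.
  rewrite sumrB sumr_const card_ord ln_powR ln_prod // -mulr_natr.
  by field; lra.
have xE i : x i = geom_mean x * expR (ln (x i) - ln (geom_mean x)).
  by rewrite expRB !lnK ?posrE // mulrC divfK // gt_eqF.
have T := sum_distinct_triples_ge (ltW G0) xE l0.
set q := _ / _ * _.
(* Multiplied by [arith_mean x ^+ 3], every term of the bracket in [q] acquires the same factor
   [n^-3]; against [n^2] this leaves the average over the [n (n-1) (n-2)] ordered triples. *)
have qE : q = ((\sum_i x i) ^+ 3 - 3 * (\sum_i x i) * (\sum_i x i ^+ 2)
    + 2 * (\sum_i x i ^+ 3)) / (n%:R * (n%:R - 1) * (n%:R - 2))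
    / arith_mean x ^+ 3.
  rewrite /q /raw_moment /arith_mean.
  field; apply/and4P; split; lra.
have N0 : 0 < n%:R * (n%:R - 1) * (n%:R - 2) :> R by rewrite !mulr_gt0 //; lra.
have Gq : geom_mean x ^+ 3 <= arith_mean x ^+ 3 * q.
  by rewrite qE mulrC divfK ?ler_pdivlMr // expf_neq0 // gt_eqF.
(* Both [powRM] and the monotonicity of the cube root need a nonnegative base. The sign of [q] is
   not visible in its formula, but [Gq] bounds [arith_mean x ^+ 3 * q] below by a positive cube. *)
have q0 : 0 <= q.
  rewrite -(pmulr_rge0 _ (exprn_gt0 3 A0)); apply: le_trans Gq.
  by rewrite exprn_ge0 // ltW.
rewrite -{1}(cbrtK _ (ltW G0)) -{1}(cbrtK _ (ltW A0)) -powRM ?exprn_ge0 ?(ltW A0) //.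
rewrite ge0_ler_powR ?nnegrE ?divr_ge0 ?exprn_ge0 ?(ltW G0) //.
by rewrite mulr_ge0 // exprn_ge0 // ltW.
Qed.
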